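(* Consider the symmetrical BSPR network with fixed $p_s,p_d\in[0,1/2)$ ($p_{s,i}=p_s$, $p_{i,d}=p_d$ for all $i$) and $K$ relays. Coded transmission with forwarding relays achieves every rate $R<R_\textnormal{coded,f}$, where $R_\textnormal{coded,f}=I(U;Y_1,\dots,Y_K)$ with $U$ uniform on $\{0,1\}$ and $Y_i=U\oplus Z_i\oplus E_i$, and $R_\textnormal{coded,f}-C\to0$ as $K\to\infty$, where $C$ is the capacity of the network with $K$ relays.
   Context: BSPR network with $K$ relays: at each network use $t$ the source sends $U[t]\in\{0,1\}$; relay $i$ receives $V_i[t]=U[t]\oplus Z_i[t]$, $\Pr\{Z_i=1\}=p_{s,i}$; relay $i$ sends $X_i[t]$ and the destination receives $Y_i[t]=X_i[t]\oplus E_i[t]$, $\Pr\{E_i=1\}=p_{i,d}$; all noises mutually independent and i.i.d. over time. An $(M,n)$ code: message $W$ uniform on $\{0,\dots,M-1\}$, source encoder on $W$, relay encoders $X_i[t]=f_{i,t}(V_i[1],\dots,V_i[t-1])$, destination decoder on all $Y_i$; rate $(\log_2M)/n$; average error probability $P_e$. $R$ is achievable if for every $\epsilon>0$ and all sufficiently large $n$ there is a $(2^{nR},n)$ code with $P_e\le\epsilon$; $C$ is the supremum of achievable rates. A forwarding relay sets $X_i[t]=V_i[t-1]$ ($X_i[1]=0$). Coded transmission with forwarding relays: all relays forward and the source uses a channel code for the effective point-to-point channel from $U$ to $(Y_1,\dots,Y_K)$ (with $n+1$ network uses for $n$ code symbols), the destination decoding from $(Y_1,\dots,Y_K)$. 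*)

(* Defs.v *)
From HB Require Import structures.
From mathcomp Require Import all_boot all_order all_algebra.
From mathcomp Require Import all_classical all_reals all_analysis.
Set Implicit Arguments. Unset Strict Implicit. Unset Printing Implicit Defensive.
Import Order.TTheory GRing.Theory Num.Theory.
Import numFieldNormedType.Exports.
Local Open Scope classical_set_scope.
Local Open Scope ring_scope.

Section BSPR.
Variable R : realType.

Definition bern (p : R) (b : bool) : R := if b then p else 1 - p.

Definition log2 (x : R) : R := ln x / ln 2.

(* sequences of n bits, indexed 0..n-1 (time t = 1..n in the paper) *)
Definition bits (n : nat) := {ffun 'I_n -> bool}.
Definition rbits (K n : nat) := {ffun 'I_K -> bits n}.

Record code (K n M : nat) := Code {
  enc : 'I_M -> 'I_n -> bool;
  relay : 'I_K -> 'I_n -> bits n -> bool;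
  dec : rbits K n -> 'I_M
}.

Definition causal K n M (c : code K n M) : Prop :=
  forall (i : 'I_K) (t : 'I_n) (v v' : bits n),
    (forall s : 'I_n, (s < t)%N -> v s = v' s) -> relay c i t v = relay c i t v'.

Definition forwarding K n M (c : code K n M) : Prop :=
  forall (i : 'I_K) (t : 'I_n) (v : bits n),
    ((val t = 0)%N -> relay c i t v = false) /\
    (forall s : 'I_n, (val s).+1 = val t -> relay c i t v = v s).

Definition Vseq K n M (c : code K n M) (w : 'I_M) (Z : rbits K n) : rbits K n :=
  [ffun i => [ffun t => enc c w t (+) Z i t]].
Definition Yseq K n M (c : code K n M) (w : 'I_M) (Z E : rbits K n) : rbits K n :=
  [ffun i => [ffun t => relay c i t (Vseq c w Z i) (+) E i t]].

Definition noise_prob K n (p : R) (Z : rbits K n) : R :=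
  \prod_(i < K) \prod_(t < n) bern p (Z i t).

Definition Pe K n M (ps pd : R) (c : code K n M) : R :=
  M%:R^-1 * \sum_(w < M) \sum_(Z : rbits K n) \sum_(E : rbits K n)
     noise_prob ps Z * noise_prob pd E * (dec c (Yseq c w Z E) != w)%:R.

Definition achievable_with (K : nat) (P : forall n M, code K n M -> Prop)
  (ps pd r : R) : Prop :=
  forall eps : R, 0 < eps -> exists N : nat, forall n : nat, (N <= n)%N ->
    exists (M : nat) (c : code K n M),
      [/\ P n M c, causal c, 2 `^ (n%:R * r) <= M%:R & Pe ps pd c <= eps].

Definition achievable (K : nat) (ps pd r : R) : Prop :=
  @achievable_with K (fun n M (_ : code K n M) => True) ps pd r.

Definition achievable_fwd (K : nat) (ps pd r : R) : Prop :=
  @achievable_with K (fun n M (c : code K n M) => forwarding c) ps pd r.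

Definition capacity (K : nat) (ps pd : R) : R :=
  sup [set r : R | achievable K ps pd r].

Definition mutual_info (A B : finType) (p : A -> B -> R) : R :=
  \sum_(a : A) \sum_(b : B)
    (if p a b == 0 then 0
     else p a b * log2 (p a b / ((\sum_(b' : B) p a b') * (\sum_(a' : A) p a' b)))).

Definition branch (ps pd : R) (u y : bool) : R :=
  \sum_(z : bool) \sum_(e : bool) bern ps z * bern pd e * ((u (+) z (+) e) == y)%:R.

Definition joint_UY (K : nat) (ps pd : R) (u : bool) (y : {ffun 'I_K -> bool}) : R :=
  2^-1 * \prod_(i < K) branch ps pd u (y i).

Definition R_coded_f (K : nat) (ps pd : R) : R := mutual_info (@joint_UY K ps pd).
End BSPR.

(* Main.v *)
Require Import Defs.
From HB Require Import structures.
From mathcomp Require Import all_boot all_order all_algebra.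
From mathcomp Require Import all_classical all_reals all_analysis.
From mathcomp Require Import ring lra.
Import Order.TTheory GRing.Theory Num.Theory.
Import numFieldNormedType.Exports.
Local Open Scope classical_set_scope.
Local Open Scope ring_scope.
Set Implicit Arguments. Unset Strict Implicit. Unset Printing Implicit Defensive.

(* Both R_coded,f and C are squeezed against 1.
   Achievability: random i.i.d. codewords with maximum likelihood decoding.  With
   the threshold gamma = g^n, a decoding error forces either Q(y|x) <= gamma P(y)
   for the sent word x, or Q(y|x') > gamma P(y) for another word x'.  A Chernoff
   bound controls the first event as soon as log2 g < I(U;Y), and Markov's
   inequality bounds the second one by (M - 1) / gamma.
   Converse: for a fixed noise realization the received word depends only on the
   source word, so at most 2^n messages are decoded correctly, and C <= 1.
   Limit: ln (1 + x) <= 2 sqrt x bounds H(U|Y) by (2 / ln 2) times the K-th power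
   of the Bhattacharyya coefficient of a single branch, which is < 1; hence
   1 - o(1) <= R_coded,f <= C <= 1. *)

(** * Product sums over finite function spaces and elementary inequalities *)

Lemma sum_ffun_prod (R : realType) (I J : finType) (F : I -> J -> R) :
  \sum_(x : {ffun I -> J}) \prod_i F i (x i) = \prod_i \sum_j F i j.
Proof. by rewrite bigA_distr_bigA. Qed.

Lemma sum_ffun_prod1 (R : realType) (I J : finType) (nu : J -> R) (i : I) (f : J -> R) :
  \sum_j nu j = 1 ->
  \sum_(C : {ffun I -> J}) (\prod_k nu (C k)) * f (C i) = \sum_j nu j * f j.
Proof.
move=> nu1.
rewrite (eq_bigr (fun C : {ffun I -> J} =>
    \prod_k (nu (C k) * (if k == i then f (C k) else 1)))); last first.
  by move=> C _; rewrite big_split /= -big_mkcond big_pred1_eq.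
rewrite -(bigA_distr_bigA (fun k j => nu j * (if k == i then f j else 1))) /=.
rewrite (bigD1 i) //= eqxx [X in _ * X]big1 ?mulr1 // => k /negPf ->.
by rewrite -[RHS]nu1; apply: eq_bigr => j _; rewrite mulr1.
Qed.

(** Distinct coordinates are independent under a product law; in random coding they are the sent
    codeword and a competitor. *)
Lemma sum_ffun_prod2 (R : realType) (I J : finType) (nu : J -> R) (i i' : I) (f f' : J -> R) :
  \sum_j nu j = 1 -> i' != i ->
  \sum_(C : {ffun I -> J}) (\prod_k nu (C k)) * (f (C i) * f' (C i')) =
  (\sum_j nu j * f j) * (\sum_j nu j * f' j).
Proof.
move=> nu1 ii'.
rewrite (eq_bigr (fun C : {ffun I -> J} =>
    \prod_k (nu (C k) * ((if k == i then f (C k) else 1) *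
                         (if k == i' then f' (C k) else 1))))); last first.
  by move=> C _; rewrite !big_split /= -!big_mkcond !big_pred1_eq.
rewrite -(bigA_distr_bigA (fun k j => nu j * ((if k == i then f j else 1) *
                         (if k == i' then f' j else 1)))) /=.
rewrite (bigD1 i) //= (bigD1 i') //= [X in _ * (_ * X)]big1 ?mulr1.
  rewrite !eqxx eq_sym (negPf ii'); congr (_ * _).
    by apply: eq_bigr => j _; rewrite mulr1.
  by apply: eq_bigr => j _; rewrite mul1r.
move=> k /andP[/negPf -> /negPf ->].
by rewrite -[RHS]nu1; apply: eq_bigr => j _; rewrite !mulr1.
Qed.

Lemma natr_forall (R : realType) (I : finType) (P : pred I) :
  ([forall i, P i])%:R = \prod_i (P i)%:R :> R.
Proof.
case: forallP => [allP|/existsNP[i /negP/negPf nPi]].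
  by rewrite big1 // => i _; rewrite allP.
by rewrite (bigD1 i) //= nPi mul0r.
Qed.

Lemma powR_prod (R : realType) (I : finType) (f : I -> R) s :
  (forall i, 0 <= f i) -> \prod_i (f i `^ s) = (\prod_i f i) `^ s.
Proof.
move=> f0; suff [] : 0 <= \prod_i f i /\ \prod_i (f i `^ s) = (\prod_i f i) `^ s by [].
apply: (big_rec2 (fun x y => 0 <= x /\ y = x `^ s)) => [|i y x _ [x0 ->]].
  by rewrite powR1.
by rewrite mulr_ge0 // powRM.
Qed.

Lemma sqrtr_prod (R : realType) (I : finType) (f : I -> R) :
  (forall i, 0 <= f i) -> Num.sqrt (\prod_i f i) = \prod_i Num.sqrt (f i).
Proof.
move=> f0; suff [] : 0 <= \prod_i f i /\
    Num.sqrt (\prod_i f i) = \prod_i Num.sqrt (f i) by [].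
apply: (big_rec2 (fun x y => 0 <= x /\ Num.sqrt x = y)) => [|i y x _ [x0 <-]].
  by rewrite sqrtr1.
by rewrite mulr_ge0 // sqrtrM.
Qed.

Lemma ltr_powR2 (R : realType) : {homo powR (2 : R) : x y / x < y}.
Proof.
move=> x y xy; rewrite /powR pnatr_eq0 /= ltr_expR ltr_pM2r //.
by rewrite ln_gt0 // ltr1n.
Qed.

(** Clearing the denominator in [expR (- x) <= (1 + x)^-1] leaves [0 <= x ^+ 2 * (1 + 2 * x)],
    whence the range of [x]. *)
Lemma expRN_le (R : realType) (x : R) : - 2^-1 <= x -> expR (- x) <= 1 - x + 2 * x ^+ 2.
Proof.
move=> x_ge; have x1 : 0 < 1 + x by lra.
rewrite expRN (@le_trans _ _ (1 + x)^-1) //.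
  by rewrite lef_pV2 ?posrE ?expR_gt0 // expR_ge1Dx.
rewrite -div1r ler_pdivrMr //.
have : 0 <= x ^+ 2 * (1 + 2 * x) by rewrite mulr_ge0 ?sqr_ge0 //; lra.
by nra.
Qed.

(** Compare [1 + x] with [(1 + Num.sqrt x) ^+ 2], then use [ln (1 + s) <= s]. *)
Lemma ln1D_le_sqrt (R : realType) (x : R) : 0 <= x -> ln (1 + x) <= 2 * Num.sqrt x.
Proof.
move=> x0; have s0 : 0 <= Num.sqrt x by exact: sqrtr_ge0.
apply: (@le_trans _ _ (ln ((1 + Num.sqrt x) ^+ 2))).
  rewrite ler_ln ?posrE ?exprn_gt0 //; try lra.
  by rewrite sqrrD expr1n sqr_sqrtr // mul1r; nra.
rewrite lnXn; last lra.
by rewrite -[leLHS]mulr_natl ler_wpM2l // le_ln1Dx //; lra.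
Qed.

(** * One-shot random coding bound *)

Section RandomCoding.
Variables (R : realType) (X Y : finType).
Variables (mu : X -> R) (Q : X -> Y -> R) (T : X -> Y -> R) (gamma : R).
Hypothesis mu_gt0 : forall x, 0 < mu x.
Hypothesis mu_sum1 : \sum_x mu x = 1.
Hypothesis Q_ge0 : forall x y, 0 <= Q x y.
Hypothesis Q_sum1 : forall x, \sum_y Q x y = 1.
Hypothesis gamma_gt0 : 0 < gamma.
Hypothesis T_ge0 : forall x y, 0 <= T x y.

Let P y := \sum_x mu x * Q x y.
(** [T] stays abstract: any majorant of [Q] where the threshold is not passed. [block_code] supplies
    a Chernoff tilt, which factorizes over time. *)
Hypothesis T_tail : forall x y, Q x y <= gamma * P y -> Q x y <= T x y.

Let P_ge0 y : 0 <= P y.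
Proof. by apply: sumr_ge0 => x _; rewrite mulr_ge0 // ltW. Qed.

Let P_gt0 x y : 0 < Q x y -> 0 < P y.
Proof.
move=> Qxy; rewrite /P (bigD1 x) //=; apply: ltr_pwDl; first exact: mulr_gt0.
by apply: sumr_ge0 => x' _; rewrite mulr_ge0 // ltW.
Qed.

Let mldec M (C : {ffun 'I_M.+1 -> X}) (y : Y) : 'I_M.+1 :=
  [arg max_(w > ord0) Q (C w) y]%O.

(** Above the threshold, an error means that the decoded word is at least as likely as the sent one,
    so its own ratio to [gamma * P y] exceeds 1. *)
Let mldec_error M (C : {ffun 'I_M.+1 -> X}) y w :
  Q (C w) y * (mldec C y != w)%:R <=
  T (C w) y + \sum_(w' | w' != w) Q (C w) y * (Q (C w') y / (gamma * P y)).
Proof.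
have sum_ge0 : 0 <= \sum_(w' | w' != w) Q (C w) y * (Q (C w') y / (gamma * P y)).
  by apply: sumr_ge0 => w' _; rewrite mulr_ge0 // divr_ge0 // mulr_ge0 // ltW.
case: eqVneq => [_|errw]; first by rewrite mulr0 addr_ge0.
rewrite mulr1; case: (leP (Q (C w) y) (gamma * P y)) => [le|gt].
  by rewrite (le_trans (T_tail le)) // lerDl.
have Pgt0 : 0 < gamma * P y.
  rewrite mulr_gt0 // (@P_gt0 (C w)) //; apply: le_lt_trans gt.
  by rewrite mulr_ge0 // ltW.
rewrite -[leLHS]add0r lerD // (bigD1 (mldec C y)) //=.
rewrite -[leLHS]addr0 lerD //; last first.
  by apply: sumr_ge0 => w' _; rewrite mulr_ge0 // divr_ge0 // mulr_ge0 // ltW.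
rewrite ler_peMr // ler_pdivlMr // mul1r (le_trans (ltW gt)) //.
by rewrite /mldec; case: arg_maxP => // w' _ /(_ w); apply.
Qed.

Lemma random_coding M :
  exists (C : 'I_M.+1 -> X) (D : Y -> 'I_M.+1),
    M.+1%:R^-1 * \sum_(w < M.+1) \sum_y Q (C w) y * (D y != w)%:R <=
    \sum_x \sum_y mu x * T x y + M%:R / gamma.
Proof.
pose B := \sum_x \sum_y mu x * T x y + M%:R / gamma.
pose err (C : {ffun 'I_M.+1 -> X}) w := \sum_y Q (C w) y * (mldec C y != w)%:R.
have nu1 : \sum_(C : {ffun 'I_M.+1 -> X}) \prod_k mu (C k) = 1.
  rewrite -(bigA_distr_bigA (fun (_ : 'I_M.+1) x => mu x)) /=.
  by rewrite big1.
have avg w : \sum_(C : {ffun 'I_M.+1 -> X}) (\prod_k mu (C k)) * err C w <= B.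
  apply: (@le_trans _ _ (\sum_(C : {ffun 'I_M.+1 -> X}) (\prod_k mu (C k)) *
    (\sum_y T (C w) y + \sum_(w' | w' != w) \sum_y
       Q (C w) y * (Q (C w') y / (gamma * P y))))).
    apply: ler_sum => C _; apply: ler_wpM2l.
      by apply: prodr_ge0 => k _; exact: ltW.
    by rewrite exchange_big -big_split /=; apply: ler_sum => y _; exact: mldec_error.
  under eq_bigr do rewrite mulrDr [X in _ + X]mulr_sumr.
  rewrite big_split /= lerD //.
    rewrite (@sum_ffun_prod1 _ _ _ mu w (fun x => \sum_y T x y)) //.
    by under eq_bigr do rewrite mulr_sumr.
  rewrite exchange_big /=.
  (* By independence of [C w] and [C w'], each competitor contributes [P y / gamma] at [y], and
     these sum to [gamma^-1]. *)
  have -> : M%:R / gamma = \sum_(w' < M.+1 | w' != w) gamma^-1.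
    by rewrite sumr_const cardC1 card_ord /= mulr_natl.
  apply: ler_sum => w' ww'.
  under eq_bigr do rewrite mulr_sumr.
  rewrite exchange_big /= -[leRHS]mulr1.
  have P1 : \sum_y P y = 1.
    rewrite /P exchange_big /= -[RHS]mu_sum1; apply: eq_bigr => x _.
    by rewrite -mulr_sumr Q_sum1 mulr1.
  rewrite -[X in _ <= _ * X]P1 [leRHS]mulr_sumr; apply: ler_sum => y _.
  rewrite (@sum_ffun_prod2 _ _ _ mu w w' (fun x => Q x y)
    (fun x => Q x y / (gamma * P y))) //.
  under [X in _ * X]eq_bigr do rewrite mulrA.
  rewrite -mulr_suml -/(P y).
  have [->|Py] := eqVneq (P y) 0; first by rewrite mul0r mulr0.
  rewrite le_eqVlt; apply/orP; left; apply/eqP; field.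
  by rewrite Py gt_eqF.
suff [C CB] : exists C : {ffun 'I_M.+1 -> X}, M.+1%:R^-1 * \sum_w err C w <= B.
  by exists C, (mldec C).
(* Were every codebook worse than [B], so would be their average; one codebook [C0] of positive
   weight makes the inequality strict. *)
apply/not_existsP => noC.
suff : B < B by rewrite ltxx.
have -> : B = \sum_(C : {ffun 'I_M.+1 -> X}) (\prod_k mu (C k)) * B.
  by rewrite -mulr_suml nu1 mul1r.
apply: (@lt_le_trans _ _ (\sum_(C : {ffun 'I_M.+1 -> X}) (\prod_k mu (C k)) *
   (M.+1%:R^-1 * \sum_w err C w))); last first.
  under eq_bigr do rewrite mulrCA mulr_sumr.
  rewrite -mulr_sumr exchange_big /= mulrC ler_pdivrMr //.
  rewrite mulr_natr -[X in _ *+ X](card_ord M.+1) -sumr_const.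
  by rewrite -mulr_suml nu1 mul1r; apply: ler_sum.
have prod_gt0 (C : {ffun 'I_M.+1 -> X}) : 0 < \prod_k mu (C k).
  by apply: prodr_gt0.
have [C0 _] : exists C : {ffun 'I_M.+1 -> X}, True.
  apply/not_existsP => noX; move: nu1; rewrite big1 => [/eqP|C].
    by rewrite eq_sym oner_eq0.
  by case: (noX C).
rewrite (bigD1 C0) //= [ltRHS](bigD1 C0) //= ltr_leD //.
  by rewrite ltr_pM2l // ltNge; apply/negP/noC.
apply: ler_sum => C _; rewrite ler_pM2l // leNgt; apply/negP => /ltW; exact: noC.
Qed.
End RandomCoding.

(** * Converse: achievable rates are at most 1 *)

Section Converse.
Variables (R : realType) (K n : nat).
Implicit Type ps pd : R.

Lemma bern_sum1 (p : R) : \sum_b bern p b = 1.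
Proof. by rewrite big_bool /= addrC subrK. Qed.

Lemma bern_ge0 (p : R) b : 0 <= p <= 1 -> 0 <= bern p b.
Proof. by case: b => /andP[p0 p1] //=; rewrite subr_ge0. Qed.

Lemma noise_prob_sum1 (p : R) : \sum_(Z : rbits K n) noise_prob p Z = 1.
Proof.
rewrite -(bigA_distr_bigA (fun i (z : bits n) => \prod_(t < n) bern p (z t))) /=.
rewrite big1 // => i _.
by rewrite -(bigA_distr_bigA (fun t b => bern p b)) big1 // => t _; exact: bern_sum1.
Qed.

Lemma noise_prob_ge0 (p : R) (Z : rbits K n) : 0 <= p <= 1 -> 0 <= noise_prob p Z.
Proof.
by move=> p01; apply: prodr_ge0 => i _; apply: prodr_ge0 => t _; exact: bern_ge0.
Qed.

(* Once the noise is fixed, the output only depends on the transmitted word,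
   so at most one message per binary word is decoded correctly. *)
Lemma correct_le_words M (c : Defs.code K n M) (Z E : rbits K n) :
  (\sum_(w < M) (dec c (Yseq c w Z E) == w) <= 2 ^ n)%N.
Proof.
pose word w : bits n := [ffun t => enc c w t].
have Yword w w' : word w = word w' -> Yseq c w Z E = Yseq c w' Z E.
  move=> ww'; have Vww' : Vseq c w Z = Vseq c w' Z.
    apply/ffunP => i; apply/ffunP => t; rewrite !ffunE.
    by move/ffunP/(_ t): ww'; rewrite !ffunE => ->.
  by rewrite /Yseq Vww'.
have -> : (2 ^ n = #|{: bits n}|)%N by rewrite card_ffun card_bool card_ord.
rewrite -sum1_card (bigID (fun w => dec c (Yseq c w Z E) == w)) /=.
rewrite [X in (_ + X)%N]big1 => [|w /negPf -> //]; rewrite addn0.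
rewrite (eq_bigr (fun=> 1%N)) => [|w -> //].
rewrite !sum1_card -(@card_in_imset _ _ word) ?max_card // => w w'.
rewrite -!topredE /= => /eqP cw /eqP cw' /Yword Yww'.
by apply: val_inj; rewrite /= -cw -cw' Yww'.
Qed.

(** Moving the noise outside the sum over messages lets the count [correct_le_words] apply to each
    noise realization. *)
Lemma Pe_lower_bound M (c : Defs.code K n M) ps pd :
  0 <= ps <= 1 -> 0 <= pd <= 1 -> (0 < M)%N ->
  1 - 2 ^+ n / M%:R <= Pe ps pd c.
Proof.
move=> ps01 pd01 M0.
have MR0 : 0 < M%:R :> R by rewrite ltr0n.
have -> : 1 - 2 ^+ n / M%:R = M%:R^-1 * (M%:R - 2 ^+ n) :> R.
  by field; rewrite gt_eqF.
rewrite /Pe ler_pM2l ?invr_gt0 //.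
rewrite exchange_big /=.
under eq_bigr do rewrite exchange_big /=.
have mass : \sum_(Z : rbits K n) \sum_(E : rbits K n)
   noise_prob ps Z * noise_prob pd E * (M%:R - 2 ^+ n) = M%:R - 2 ^+ n.
  under eq_bigr => Z _ do rewrite -mulr_suml -mulr_sumr noise_prob_sum1 mulr1.
  by rewrite -mulr_suml noise_prob_sum1 mul1r.
rewrite -[leLHS]mass; apply: ler_sum => Z _; apply: ler_sum => E _.
rewrite -mulr_sumr ler_wpM2l ?mulr_ge0 ?noise_prob_ge0 //.
rewrite lerBlDr -natr_sum -natrX -natrD ler_nat.
have {1}-> : M = (\sum_(w < M) (dec c (Yseq c w Z E) != w) +
            \sum_(w < M) (dec c (Yseq c w Z E) == w))%N.
  rewrite -big_split /= -[LHS](card_ord M) -sum1_card.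
  by apply: eq_bigr => w _; case: eqP.
by rewrite leq_add2l correct_le_words.
Qed.

End Converse.

Lemma achievable_le1 (R : realType) (K : nat) (ps pd r : R) :
  0 <= ps <= 1 -> 0 <= pd <= 1 -> achievable K ps pd r -> r <= 1.
Proof.
move=> ps01 pd01 ach; rewrite leNgt; apply/negP => r1.
have [N HN] := ach 2^-1 ltac:(by []).
have d0 : 0 < r - 1 by rewrite subr_gt0.
(* This [n] gives [n * (r - 1) > 1], so [M] exceeds [2 * 2 ^ n] and the error probability exceeds
   one half. *)
pose n := (N + (Num.truncn (r - 1)^-1).+1)%N.
have nd : 1 < n%:R * (r - 1).
  rewrite -ltr_pdivrMr // div1r.
  apply: (lt_le_trans (truncnS_gt _)).
  by rewrite ler_nat leq_addl.
have [M [c [_ _ leM Pec]]] := HN n (leq_addr _ _).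
have M0 : 0 < M%:R :> R by apply: lt_le_trans leM; exact: powR_gt0.
have := Pe_lower_bound c ps01 pd01; rewrite -(ltr0n R) => /(_ M0) lo.
have : 2 ^+ n / M%:R < 2^-1 :> R.
  rewrite ltr_pdivrMr //.
  rewrite -(powR_mulrn n) //; apply: lt_le_trans (_ : 2^-1 * 2 `^ (n%:R * r) <= _).
    rewrite mulrC ltr_pdivlMr // mulrC -{1}(powRr1 (_ : 0 <= 2)) // -powRD; last first.
      by rewrite pnatr_eq0 implybT.
    by apply: ltr_powR2; lra.
  by rewrite ler_wpM2l.
lra.
Qed.

(** * Coding theorem for memoryless channels *)

Section ChannelCoding.
Variables (R : realType) (A B : finType) (mu : A -> R) (q : A -> B -> R).
Hypothesis mu_gt0 : forall a, 0 < mu a.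
Hypothesis mu_sum1 : \sum_a mu a = 1.
Hypothesis q_ge0 : forall a b, 0 <= q a b.
Hypothesis q_sum1 : forall a, \sum_b q a b = 1.

Let p b := \sum_a mu a * q a b.

Let p_ge0 b : 0 <= p b.
Proof. by apply: sumr_ge0 => a _; rewrite mulr_ge0 // ltW. Qed.

Let p_gt0 a b : 0 < q a b -> 0 < p b.
Proof.
move=> qab; rewrite /p (bigD1 a) //=; apply: ltr_pwDl; first exact: mulr_gt0.
by apply: sumr_ge0 => a' _; rewrite mulr_ge0 // ltW.
Qed.

Let joint_sum1 : \sum_a \sum_b mu a * q a b = 1.
Proof.
by rewrite -mu_sum1; apply: eq_bigr => a _; rewrite -mulr_sumr q_sum1 mulr1.
Qed.

Lemma mutual_info_channel :
  mutual_info (fun a b => mu a * q a b) * ln 2 =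
  \sum_a \sum_b mu a * q a b * ln (q a b / p b).
Proof.
rewrite /mutual_info mulr_suml; apply: eq_bigr => a _.
rewrite mulr_suml; apply: eq_bigr => b _.
case: eqP => [->|/eqP]; first by rewrite !mul0r.
rewrite mulf_eq0 negb_or => /andP[mu0 q0].
rewrite -mulr_sumr q_sum1 mulr1 -/(p b) /log2 -mulrA divfK; last first.
  by rewrite gt_eqF // ln_gt0 // ltr1n.
congr (_ * ln _); rewrite invfM mulrA; congr (_ / _).
by rewrite mulrC mulKf.
Qed.

(** Where [0 < q a b <= g * p b] the power is at least 1 for [s > 0], so the tilt dominates [q]; its
    products over time dominate on the block tail event as well. *)
Let tilt (g s : R) a b := q a b * (g * p b / q a b) `^ s.

(* The derivative at [s = 0] of the left-hand side is
   [ln g - mutual_info * ln 2 < 0]. *)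
Lemma chernoff_lt1 (g : R) :
  0 < g -> ln g < mutual_info (fun a b => mu a * q a b) * ln 2 ->
  exists2 s, 0 < s & \sum_a \sum_b mu a * tilt g s a b < 1.
Proof.
move=> g0; rewrite mutual_info_channel => gI.
(* The tilt is [q a b * expR (- (s * J a b))], and the mean [d] of [J] is the gap between the mutual
   information in nats and [ln g]. *)
pose J a b := ln (q a b / p b) - ln g.
pose d := \sum_a \sum_b mu a * q a b * J a b.
have d0 : 0 < d.
  rewrite /d; under eq_bigr do under eq_bigr do rewrite mulrBr.
  under eq_bigr do rewrite big_split /= sumrN -mulr_suml.
  by rewrite big_split /= sumrN -mulr_suml joint_sum1 mul1r subr_gt0.
(* Besides bounding every [J a b] in absolute value, [b0] is at least [d], hence positive, thanks to
   the added [d]. *)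
pose b0 := \sum_a \sum_b `|J a b| + d.
have J_le a b : `|J a b| <= b0.
  rewrite /b0 (bigD1 a) //= (bigD1 b) //= -!addrA lerDl !addr_ge0 ?(ltW d0) //.
    by apply: sumr_ge0.
  by apply: sumr_ge0 => a' _; apply: sumr_ge0.
have db : d <= b0.
  by rewrite lerDr; apply: sumr_ge0 => a _; apply: sumr_ge0.
have b00 : 0 < b0 by exact: lt_le_trans db.
(* Small enough for [s * b0 <= 2^-1], the range of [expRN_le], and for [2 * s * b0 ^+ 2 < d], so
   that the linear gain beats the quadratic error. *)
pose s := d / (4 * (b0 + 1) ^+ 2).
have den0 : 0 < 4 * (b0 + 1) ^+ 2 by rewrite mulr_gt0 // exprn_gt0 //; lra.
have s0 : 0 < s by rewrite divr_gt0.
have sE : s * (4 * (b0 + 1) ^+ 2) = d by rewrite divfK // gt_eqF.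
have sb : s * b0 <= 2^-1.
  rewrite /s mulrAC ler_pdivrMr //.
  apply: (@le_trans _ _ (b0 * b0)); first by rewrite ler_wpM2r // ltW.
  nra.
have sb2 : 2 * s * b0 ^+ 2 < d by rewrite -sE; nra.
exists s => //.
apply: (@le_lt_trans _ _ (\sum_a \sum_b (mu a * q a b -
   s * (mu a * q a b * J a b) + (mu a * q a b) * (2 * s ^+ 2 * b0 ^+ 2)))).
  apply: ler_sum => a _; apply: ler_sum => b _.
  have [q0|q_neq0] := eqVneq (q a b) 0.
    by rewrite /tilt q0 !(mul0r, mulr0) subr0 addr0.
  have qab : 0 < q a b by rewrite lt_neqAle eq_sym q_neq0 q_ge0.
  have -> : tilt g s a b = q a b * expR (- (s * J a b)).
    have pb := p_gt0 qab.
    rewrite /tilt /powR gt_eqF ?divr_gt0 ?mulr_gt0 // -mulrN; congr (_ * expR (_ * _)).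
    rewrite (_ : g * p b / q a b = g / (q a b / p b)); last by rewrite invf_div mulrA.
    by rewrite lnM ?lnV ?posrE ?invr_gt0 ?divr_gt0 // /J opprB.
  have /andP[Jlo Jhi] : - b0 <= J a b <= b0 by rewrite -ler_norml.
  have J2 : (s * J a b) ^+ 2 <= s ^+ 2 * b0 ^+ 2.
    by rewrite exprMn ler_wpM2l ?sqr_ge0 //; nra.
  have expJ : expR (- (s * J a b)) <= 1 - s * J a b + 2 * s ^+ 2 * b0 ^+ 2.
    by apply: le_trans (expRN_le _) _; [nra | lra].
  rewrite mulrA (le_trans (ler_wpM2l _ expJ)) ?mulr_ge0 ?(ltW (mu_gt0 a)) //.
  by rewrite le_eqVlt; apply/orP; left; apply/eqP; ring.
have -> : \sum_a \sum_b (mu a * q a b - s * (mu a * q a b * J a b) +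
    mu a * q a b * (2 * s ^+ 2 * b0 ^+ 2)) = 1 - s * d + 2 * s ^+ 2 * b0 ^+ 2.
  rewrite /d -[X in _ + X]mul1r -joint_sum1 mulr_sumr mulr_suml -sumrB -big_split /=.
  apply: eq_bigr => a _.
  by rewrite mulr_sumr mulr_suml -sumrB -big_split.
have : 0 < s * (d - 2 * s * b0 ^+ 2) by rewrite mulr_gt0 // subr_gt0.
by nra.
Qed.

(** Input law, channel and tilt are products over the [n] letters, so the tail term of
    [random_coding] becomes an [n]-th power. *)
Lemma block_code n M (g s : R) :
  0 < g -> 0 < s ->
  exists (C : 'I_M.+1 -> {ffun 'I_n -> A}) (D : {ffun 'I_n -> B} -> 'I_M.+1),
    M.+1%:R^-1 * \sum_(w < M.+1) \sum_(y : {ffun 'I_n -> B})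
      (\prod_t q (C w t) (y t)) * (D y != w)%:R <=
    (\sum_a \sum_b mu a * tilt g s a b) ^+ n + M%:R / g ^+ n.
Proof.
move=> g0 s0.
pose Mu (x : {ffun 'I_n -> A}) := \prod_t mu (x t).
pose Q (x : {ffun 'I_n -> A}) (y : {ffun 'I_n -> B}) := \prod_t q (x t) (y t).
pose T (x : {ffun 'I_n -> A}) (y : {ffun 'I_n -> B}) := \prod_t tilt g s (x t) (y t).
have tilt_ge0 a b : 0 <= tilt g s a b by rewrite mulr_ge0 ?powR_ge0.
have PE y : \sum_x Mu x * Q x y = \prod_t p (y t).
  rewrite /p -(sum_ffun_prod (fun t a => mu a * q a (y t))).
  by apply: eq_bigr => x _; rewrite -big_split.
have Q_ge0 x y : 0 <= Q x y by apply: prodr_ge0.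
have -> : (\sum_a \sum_b mu a * tilt g s a b) ^+ n = \sum_x \sum_y Mu x * T x y.
  rewrite -[n in LHS]card_ord -prodr_const.
  rewrite -(sum_ffun_prod (fun t a => \sum_b mu a * tilt g s a b)).
  apply: eq_bigr => x _.
  rewrite -(sum_ffun_prod (fun t b => mu (x t) * tilt g s (x t) b)).
  by apply: eq_bigr => y _; rewrite big_split.
apply: (@random_coding R _ _ Mu Q T (g ^+ n)).
- by move=> x; apply: prodr_gt0.
- by rewrite /Mu (sum_ffun_prod (fun _ a => mu a)) big1.
- exact: Q_ge0.
- by move=> x; rewrite /Q (sum_ffun_prod (fun t b => q (x t) b)) big1.
- exact: exprn_gt0.
- by move=> x y; apply: prodr_ge0.
move=> x y; rewrite PE => leP.
have [->|Qxy] := eqVneq (Q x y) 0; first by apply: prodr_ge0.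
have qxy t : 0 < q (x t) (y t).
  rewrite lt_neqAle q_ge0 andbT eq_sym; apply: contraNneq Qxy => q0.
  by rewrite /Q (bigD1 t) //= q0 mul0r.
(* The tail condition says that the product of the ratios [g * p / q] is at least 1; so is its power
   [s]. *)
rewrite /T big_split /= -/(Q x y) ler_peMr //.
rewrite powR_prod; last by move=> t; rewrite divr_ge0 // mulr_ge0 // ltW.
have one_powR : 1 `^ s = 1 :> R by rewrite powR1.
rewrite -[leLHS]one_powR ge0_ler_powR ?nnegrE ?(ltW s0) //.
  by apply: prodr_ge0 => t _; rewrite divr_ge0 // mulr_ge0 // ltW.
rewrite big_split /= prodfV big_split /= prodr_const card_ord.
by rewrite ler_pdivlMr ?mul1r // lt_neqAle eq_sym Qxy Q_ge0.
Qed.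

(** The number of messages is measured against [n.+1] because forwarding costs one extra network
    use. *)
Lemma channel_coding (r : R) :
  0 <= r -> r < mutual_info (fun a b => mu a * q a b) ->
  forall eps, 0 < eps -> \forall n \near \oo,
    exists M (C : 'I_M -> {ffun 'I_n -> A}) (D : {ffun 'I_n -> B} -> 'I_M),
      2 `^ (n.+1%:R * r) <= M%:R /\
      M%:R^-1 * \sum_(w < M) \sum_(y : {ffun 'I_n -> B})
        (\prod_t q (C w t) (y t)) * (D y != w)%:R <= eps.
Proof.
set I := mutual_info _ => r0 rI eps eps0.
(* Strictly between [r] and [I]: below [I] so that [phi < 1], above [r] so that the number of
   messages over the threshold decays like [h ^+ n]. *)
pose r' := (r + I) / 2.
have ln2 : 0 < ln 2 :> R by rewrite ln_gt0 // ltr1n.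
pose g : R := 2 `^ r'.
have g0 : 0 < g by exact: powR_gt0.
have [s s0 phi1] : exists2 s, 0 < s & \sum_a \sum_b mu a * tilt g s a b < 1.
  apply: chernoff_lt1 => //; rewrite -/I /g ln_powR ltr_pM2r // /r'; lra.
set phi := \sum_a _ in phi1.
have phi0 : 0 <= phi.
  apply: sumr_ge0 => a _; apply: sumr_ge0 => b _.
  by rewrite !mulr_ge0 ?powR_ge0 // ltW.
pose h : R := 2 `^ r / g.
have h0 : 0 < h by rewrite divr_gt0 // powR_gt0.
have h1 : h < 1.
  by rewrite ltr_pdivrMr // mul1r; apply: ltr_powR2; rewrite /r'; lra.
have cvg0 : (fun n => phi ^+ n + 2 `^ r * h ^+ n) @ \oo --> (0 : R).
  rewrite -[X in _ --> X](addr0 0) -[X in _ --> _ + X](mulr0 (2 `^ r)).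
  apply: cvgD; first by apply: cvg_expr; rewrite ger0_norm.
  by apply: cvgMr; apply: cvg_expr; rewrite gtr0_norm.
have [N _ HN] := (cvgrPdist_le _ _).1 cvg0 _ eps0.
exists N => // n /HN /=; rewrite sub0r normrN => bound.
(* The [M] competitors stay within the target count, while the [M.+1] messages exceed it. *)
pose M := Num.truncn (2 `^ (n.+1%:R * r)).
have /andP[M_le M_gt] := truncn_itv (powR_ge0 2 (n.+1%:R * r)).
have [C [D CD]] := @block_code n M g s g0 s0.
exists M.+1, C, D; split; first exact: ltW.
apply: (le_trans CD); apply: le_trans (le_trans (ler_norm _) bound).
rewrite lerD2l ler_pdivrMr ?exprn_gt0 // (le_trans M_le) //.
rewrite -mulrA -exprMn divfK ?gt_eqF //.
by rewrite -exprS -powR_mulrn ?powR_ge0 // -powRrM mulrC.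
Qed.

End ChannelCoding.

(** * Forwarding relays as a memoryless channel with unit delay *)

Section Forwarding.
Variables (R : realType) (K : nat) (ps pd : R).
Hypotheses (ps01 : 0 <= ps <= 1) (pd01 : 0 <= pd <= 1).

Definition relay_channel (u : bool) (y : {ffun 'I_K -> bool}) : R :=
  \prod_(i < K) branch ps pd u (y i).

Lemma branch_ge0 u y : 0 <= branch ps pd u y.
Proof.
apply: sumr_ge0 => z _; apply: sumr_ge0 => e _.
by rewrite !mulr_ge0 ?bern_ge0.
Qed.

Lemma branch_sum1 u : \sum_y branch ps pd u y = 1.
Proof. by rewrite /branch !big_bool /=; case: u => /=; ring. Qed.

Lemma relay_channel_ge0 u y : 0 <= relay_channel u y.
Proof. by apply: prodr_ge0 => i _; exact: branch_ge0. Qed.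

Lemma relay_channel_sum1 u : \sum_y relay_channel u y = 1.
Proof.
rewrite -(bigA_distr_bigA (fun i y => branch ps pd u y)) big1 // => i _.
exact: branch_sum1.
Qed.

(* The observation of time [t.+1] sees the source symbol of time [t]; the
   first received symbol and the last source symbol are unused. *)
Definition delayed m (y : rbits K m.+1) : {ffun 'I_m -> {ffun 'I_K -> bool}} :=
  [ffun t : 'I_m => [ffun i => y i (lift ord0 t)]].

(** A code of length [m] runs in [m.+1] uses: [unlift ord_max] singles out the last source time and
    [unlift ord0] the first relay time, where [false] is sent. *)
Definition fwd_code m M (C : 'I_M -> {ffun 'I_m -> bool})
    (D : {ffun 'I_m -> {ffun 'I_K -> bool}} -> 'I_M) : Defs.code K m.+1 M :=
  {| enc := fun w t => if unlift ord_max t is Some s then C w s else false;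
     relay := fun _ t v => if unlift ord0 t is Some s then v (lift ord_max s) else false;
     dec := fun y => D (delayed y) |}.

Lemma unlift_ord0_succ m (t s : 'I_m.+1) :
  (val s).+1 = val t -> exists2 u, unlift ord0 t = Some u & s = lift ord_max u.
Proof.
move=> st; case: (unliftP ord0 t) => [u tu|t0]; last by rewrite t0 in st.
exists u => //; apply: ord_inj; rewrite lift_max.
by move: st; rewrite tu => -[].
Qed.

Lemma fwd_code_forwarding m M C D : forwarding (@fwd_code m M C D).
Proof.
move=> i t v; split=> /= [t0|s st].
  by have -> : t = ord0; [exact: val_inj | rewrite unlift_none].
by have [u -> ->] := unlift_ord0_succ st.
Qed.

Lemma fwd_code_causal m M C D : causal (@fwd_code m M C D).
Proof.
move=> i t v v' vv' /=; case: unliftP => // s ts.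
by apply: vv'; rewrite ts lift_max.
Qed.

(** Letter [t] meets the source noise of time [t] and the destination noise of time [t.+1].
    Different letters use disjoint noise coordinates, and the two left over sum to 1. *)
Lemma sum_delayed_noise m (d : 'I_m -> bool -> bool -> R) :
  \sum_(z : bits m.+1) \sum_(e : bits m.+1)
    (\prod_t bern ps (z t)) * (\prod_t bern pd (e t)) *
    \prod_(t < m) d t (z (lift ord_max t)) (e (lift ord0 t)) =
  \prod_(t < m) \sum_z \sum_e bern ps z * bern pd e * d t z e.
Proof.
pose dE (t : 'I_m) z := \sum_e bern pd e * d t z e.
transitivity (\sum_(z : bits m.+1) (\prod_t bern ps (z t)) *
    \prod_(t < m) dE t (z (lift ord_max t))).
  apply: eq_bigr => z _; under [LHS]eq_bigr => e _ do rewrite -mulrA.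
  rewrite -mulr_sumr; congr (_ * _).
  pose F (t : 'I_m.+1) e := bern pd e *
    (if unlift ord0 t is Some s then d s (z (lift ord_max s)) e else 1).
  transitivity (\sum_(e : bits m.+1) \prod_t F t (e t)).
    apply: eq_bigr => e _; rewrite big_split /=; congr (_ * _).
    rewrite [RHS]big_ord_recl unlift_none mul1r.
    by apply: eq_bigr => t _; rewrite liftK.
  rewrite -bigA_distr_bigA big_ord_recl /=.
  rewrite [X in X * _](_ : _ = 1) ?mul1r; last first.
    by rewrite -(bern_sum1 pd); apply: eq_bigr => e _; rewrite /F unlift_none mulr1.
  by apply: eq_bigr => t _; apply: eq_bigr => e _; rewrite /F liftK.
pose F (t : 'I_m.+1) z := bern ps z *
  (if unlift ord_max t is Some s then dE s z else 1).
transitivity (\sum_(z : bits m.+1) \prod_t F t (z t)).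
  apply: eq_bigr => z _; rewrite big_split /=; congr (_ * _).
  rewrite [RHS]big_ord_recr unlift_none /= mulr1.
  apply: eq_bigr => t _.
  have -> : widen_ord (leqnSn m) t = lift ord_max t.
    by apply: ord_inj; rewrite lift_max.
  by rewrite liftK.
rewrite -bigA_distr_bigA big_ord_recr /=.
rewrite [X in _ * X](_ : _ = 1) ?mulr1; last first.
  by rewrite -(bern_sum1 ps); apply: eq_bigr => z _; rewrite /F unlift_none mulr1.
apply: eq_bigr => t _; apply: eq_bigr => z _; rewrite /F.
have -> : widen_ord (leqnSn m) t = lift ord_max t.
  by apply: ord_inj; rewrite lift_max.
by rewrite liftK /dE mulr_sumr; apply: eq_bigr => e _; rewrite mulrA.
Qed.

(** The relays are independent and [sum_delayed_noise] separates the letters of each one, so the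
    delayed outputs follow a memoryless channel. *)
Lemma fwd_code_output m M C D w (y : {ffun 'I_m -> {ffun 'I_K -> bool}}) :
  \sum_(Z : rbits K m.+1) \sum_(E : rbits K m.+1)
    noise_prob ps Z * noise_prob pd E *
    (delayed (Yseq (@fwd_code m M C D) w Z E) == y)%:R =
  \prod_t relay_channel (C w t) (y t).
Proof.
pose d i t z e : R := ((C w t (+) z (+) e) == y t i)%:R.
pose G i (z e : bits m.+1) := (\prod_t bern ps (z t)) * (\prod_t bern pd (e t)) *
    \prod_(t < m) d i t (z (lift ord_max t)) (e (lift ord0 t)).
transitivity (\sum_(Z : rbits K m.+1) \sum_(E : rbits K m.+1) \prod_i G i (Z i) (E i)).
  apply: eq_bigr => Z _; apply: eq_bigr => E _.
  rewrite !big_split /= -/(noise_prob ps Z) -/(noise_prob pd E); congr (_ * _).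
  have -> : (delayed (Yseq (fwd_code C D) w Z E) == y) =
    [forall i, [forall t : 'I_m,
       C w t (+) Z i (lift ord_max t) (+) E i (lift ord0 t) == y t i]].
    apply/eqP/'forall_'forall_eqP => [<- i t|Yy].
      by rewrite !ffunE /= liftK !ffunE /= liftK.
    apply/ffunP => t; apply/ffunP => i; rewrite -Yy.
    by rewrite !ffunE /= liftK !ffunE /= liftK.
  by rewrite natr_forall; apply: eq_bigr => i _; rewrite natr_forall.
transitivity (\prod_(i < K) \sum_z \sum_e G i z e).
  rewrite bigA_distr_bigA; apply: eq_bigr => Z _.
  by rewrite (bigA_distr_bigA (fun i e => G i (Z i) e)).
rewrite exchange_big /=; apply: eq_bigr => i _.
exact: sum_delayed_noise.
Qed.

Lemma Pe_fwd_code m M C D :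
  Pe ps pd (@fwd_code m M C D) =
  M%:R^-1 * \sum_(w < M) \sum_(y : {ffun 'I_m -> {ffun 'I_K -> bool}})
    (\prod_t relay_channel (C w t) (y t)) * (D y != w)%:R.
Proof.
congr (_ * _); apply: eq_bigr => w _.
under [RHS]eq_bigr do rewrite -(fwd_code_output C D) mulr_suml.
rewrite [RHS]exchange_big /=; apply: eq_bigr => Z _.
under [RHS]eq_bigr do rewrite mulr_suml.
rewrite [RHS]exchange_big /=; apply: eq_bigr => E _.
(* Only the actual delayed output contributes to the sum over [y]. *)
rewrite (bigD1 (delayed (Yseq (fwd_code C D) w Z E))) //= eqxx mulr1.
by rewrite big1 ?addr0 // => y; rewrite eq_sym => /negPf ->; rewrite mulr0 mul0r.
Qed.

Lemma fwd_achievable r : r < R_coded_f K ps pd -> achievable_fwd K ps pd r.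
Proof.
move=> rI eps eps0; have [r0|r0] := leP 0 r; last first.
  (* At a negative rate a single message suffices, and it is never decoded wrongly. *)
  exists 1%N => -[|m] // _.
  exists 1%N, (fwd_code (fun=> [ffun=> false]) (fun=> ord0)); split.
  - exact: fwd_code_forwarding.
  - exact: fwd_code_causal.
  - by rewrite -[leRHS](powRr0 2) ler_powR ?ler1n // nmulr_lle0.
  rewrite (le_trans _ (ltW eps0)) // /Pe big1 ?mulr0 // => w _.
  by rewrite big1 // => Z _; rewrite big1 // => E _; rewrite (ord1 w) mulr0.
have := @channel_coding R bool {ffun 'I_K -> bool} (fun=> 2^-1) relay_channel.
case/(_ _ _ relay_channel_ge0 relay_channel_sum1 r r0 _ eps eps0) => //.
- by rewrite big_bool /=; lra.
move=> N _ HN; exists N.+1 => -[|m] // Nm.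
have [M [C [D [leM PeM]]]] := HN m Nm.
exists M, (fwd_code C D); split => //.
- exact: fwd_code_forwarding.
- exact: fwd_code_causal.
by rewrite Pe_fwd_code.
Qed.

End Forwarding.

(** * Asymptotics for many relays *)

Section ManyRelays.
Variables (R : realType) (ps pd : R).
Hypotheses (ps01 : 0 <= ps <= 1) (pd01 : 0 <= pd <= 1).

Let bhatta : R := Num.sqrt (branch ps pd true true * branch ps pd false true) +
  Num.sqrt (branch ps pd true false * branch ps pd false false).

(** The Bhattacharyya coefficient is multiplicative over independent branches. *)
Lemma sum_sqrt_relay_channel K :
  \sum_y Num.sqrt (@relay_channel R K ps pd true y * relay_channel ps pd false y) =
  bhatta ^+ K.
Proof.
transitivity (\sum_(y : {ffun 'I_K -> bool}) \prod_i
    Num.sqrt (branch ps pd true (y i) * branch ps pd false (y i))).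
  apply: eq_bigr => y _; rewrite -sqrtr_prod => [|i]; last by rewrite mulr_ge0 ?branch_ge0.
  by rewrite big_split.
rewrite -(bigA_distr_bigA (fun i b =>
    Num.sqrt (branch ps pd true b * branch ps pd false b))) /=.
by rewrite -[K in RHS]card_ord -prodr_const; apply: eq_bigr => i _; rewrite big_bool.
Qed.

(** With [x] the likelihood ratio of the other input, each logarithm is [ln 2 - ln (1 + x)]; by
    [ln1D_le_sqrt] the weighted loss is at most the geometric mean of the two likelihoods. *)
Lemma R_coded_f_ge K : 1 - 2 / ln 2 * bhatta ^+ K <= R_coded_f K ps pd.
Proof.
have ln2 : 0 < ln 2 :> R by rewrite ln_gt0 // ltr1n.
pose Q := @relay_channel R K ps pd.
have Q0 u y : 0 <= Q u y by exact: relay_channel_ge0.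
rewrite -(ler_pM2r ln2).
have -> : R_coded_f K ps pd = mutual_info (fun u y => 2^-1 * Q u y) by [].
rewrite mutual_info_channel; last exact: relay_channel_sum1.
have mass : \sum_u \sum_y 2^-1 * Q u y = 1.
  under eq_bigr do rewrite -mulr_sumr relay_channel_sum1 //.
  by rewrite big_bool /=; lra.
rewrite mulrBl mul1r mulrAC divfK ?gt_eqF //.
(* The factor 2 counts the two inputs [u], which share the same subtracted sum. *)
have -> : ln 2 - 2 * bhatta ^+ K = \sum_u \sum_y (2^-1 * Q u y * ln 2 -
    Num.sqrt (Q true y * Q false y)).
  under eq_bigr do rewrite big_split /= sumrN sum_sqrt_relay_channel -mulr_suml.
  rewrite big_split /= -mulr_suml mass mul1r sumrN sumr_const card_bool.
  by rewrite mulr_natl.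
apply: ler_sum => u _; apply: ler_sum => y _.
have [->|Qn0] := eqVneq (Q u y) 0.
  by rewrite mulr0 !mul0r add0r oppr_le0 sqrtr_ge0.
have Qgt0 : 0 < Q u y by rewrite lt_neqAle eq_sym Qn0 Q0.
pose x := Q (~~ u) y / Q u y.
have x0 : 0 <= x by rewrite divr_ge0.
have -> : Q u y / (\sum_a 2^-1 * Q a y) = 2 / (1 + x).
  have S0 : 0 < Q true y + Q false y.
    by case: (u) Qgt0 => h; [apply: ltr_pwDl | apply: ltr_wpDl].
  rewrite big_bool /= /x; move: S0 Qgt0; clear; case: u => /= S0 Qgt0; field.
    by rewrite !gt_eqF //; lra.
  by rewrite !gt_eqF //; lra.
rewrite lnM ?lnV ?posrE ?invr_gt0 //; [|lra..].
rewrite mulrDr lerD2l mulrN lerN2.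
have -> : Num.sqrt (Q true y * Q false y) = 2^-1 * Q u y * (2 * Num.sqrt x).
  have -> : Q true y * Q false y = Q u y ^+ 2 * x.
    by rewrite /x; case: (u) Qn0 => /= Qn0; field.
  rewrite sqrtrM ?sqr_ge0 // sqrtr_sqr ger0_norm //; by field.
by rewrite ler_wpM2l ?mulr_ge0 ?invr_ge0 // ln1D_le_sqrt.
Qed.

End ManyRelays.

(** The two hops form a binary symmetric channel with crossover probability [e < 2^-1], whose
    coefficient is twice the square root of [(1 - e) * e]. *)
Lemma bhattacharyya_lt1 (R : realType) (ps pd : R) :
  0 <= ps -> ps < 2^-1 -> 0 <= pd -> pd < 2^-1 ->
  Num.sqrt (branch ps pd true true * branch ps pd false true) +
  Num.sqrt (branch ps pd true false * branch ps pd false false) < 1.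
Proof.
move=> ps0 ps1 pd0 pd1.
pose e := ps * (1 - pd) + pd * (1 - ps).
have e0 : 0 <= e by rewrite /e; nra.
have e1 : e < 2^-1 by rewrite /e; nra.
have -> : branch ps pd true true = 1 - e by rewrite /branch !big_bool /= /e; ring.
have -> : branch ps pd false true = e by rewrite /branch !big_bool /= /e; ring.
have -> : branch ps pd true false = e by rewrite /branch !big_bool /= /e; ring.
have -> : branch ps pd false false = 1 - e by rewrite /branch !big_bool /= /e; ring.
rewrite [e * _]mulrC.
suff : Num.sqrt ((1 - e) * e) < 2^-1 by lra.
rewrite -[ltRHS]ger0_norm // -sqrtr_sqr ltr_sqrt; first nra.
by rewrite exprn_gt0.
Qed.

(** * Squeeze of the rate and the capacity *)

Unset Implicit Arguments.

Theorem theorem9 (R : realType) (ps pd : R) :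
  0 <= ps -> ps < 2^-1 -> 0 <= pd -> pd < 2^-1 ->
  (forall (K : nat) (r : R), r < R_coded_f K ps pd -> achievable_fwd K ps pd r) /\
  ((fun K : nat => R_coded_f K ps pd - capacity K ps pd) @ \oo --> (0 : R)).
Proof.
move=> ps0 ps1 pd0 pd1.
have ps01 : 0 <= ps <= 1 by apply/andP; split; lra.
have pd01 : 0 <= pd <= 1 by apply/andP; split; lra.
split=> [K r|]; first exact: fwd_achievable.
have ach K r : r < R_coded_f K ps pd -> achievable K ps pd r.
  move=> /(fwd_achievable ps01 pd01) fwd eps /fwd[N HN]; exists N => n /HN[M [c [_ ? ? ?]]].
  by exists M, c.
have ubC K : ubound [set r | achievable K ps pd r] 1.
  by move=> r; exact: achievable_le1.
have leC K : R_coded_f K ps pd <= capacity K ps pd.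
  (* Achievability holds strictly below [R_coded_f], hence the slack [e]. *)
  apply/ler_addgt0Pr => e e0; rewrite -lerBlDr.
  apply: ub_le_sup; first by exists 1; exact: ubC.
  by apply: ach; rewrite ltrBlDr ltrDl.
have C1 K : capacity K ps pd <= 1.
  apply: ge_sup; last exact: ubC.
  (* Bounding the supremum requires a nonempty set; any rate below [R_coded_f] is a witness. *)
  by exists (R_coded_f K ps pd - 1); apply: ach; rewrite ltrBlDr ltrDl.
set b : R := Num.sqrt (branch ps pd true true * branch ps pd false true) +
  Num.sqrt (branch ps pd true false * branch ps pd false false).
have b0 : 0 <= b by rewrite addr_ge0 ?sqrtr_ge0.
have b1 : b < 1 by exact: bhattacharyya_lt1.
have cvgb : (fun K => - (2 / ln 2 * b ^+ K)) @ \oo --> (0 : R).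
  rewrite -[X in _ --> X]oppr0 -[X in _ --> - X](mulr0 (2 / ln 2)).
  by apply: cvgN; apply: cvgMr; apply: cvg_expr; rewrite ger0_norm.
apply: (squeeze_cvgr _ cvgb (cvg_cst 0)); near=> K.
have := R_coded_f_ge ps01 pd01 K; have := C1 K; have := leC K; rewrite -/b => h1 h2 h3.
by apply/andP; split; lra.
Unshelve. all: by end_near.
Qed.
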